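(* Let $G$ be a connected graph with $n$ vertices and matching number $k$, where $2\le k\le\lfloor n/2\rfloor$. If $4\le n\le 6$ and $k=\lfloor n/2\rfloor$, then $\sigma_2(G)\ge\binom n2$, with equality if and only if $G=K_n$. Otherwise, $\sigma_2(G)\ge 2n+4k-6$, with equality if and only if $G=K_1\vee\big((k-1)K_2+\overline{K}_{n+1-2k}\big)$.
   Context: All graphs are finite, simple, undirected. For a connected graph $G$ and $u\in V(G)$, $\varepsilon_G(u)=\max_v d_G(u,v)$, and $\sigma_2(G)=\sum_{uv\in E(G)}\varepsilon_G(u)\varepsilon_G(v)$. The matching number is the maximum number of pairwise disjoint edges. $K_r$ is the complete graph, $\overline{K}_r$ the edgeless graph on $r$ vertices, $(k-1)K_2$ is a disjoint union of $k-1$ edges; $G+H$ is the disjoint union and $G\vee H$ (the join) is obtained from $G+H$ by adding all edges between $V(G)$ and $V(H)$. *)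

(* Defs.v *)
(* A simple graph is a symmetric irreflexive relation g on a finType T. *)
From mathcomp Require Import all_boot.
Set Implicit Arguments. Unset Strict Implicit. Unset Printing Implicit Defensive.

Section Graphs.
Variables (T : finType) (g : rel T).

Definition connected_graph : Prop := forall u v : T, connect g u v.

Fixpoint ball (i : nat) (u : T) : {set T} :=
  if i is m.+1 then ball m u :|: [set y | [exists x in ball m u, g x y]]
  else [set u].

(* d_G(u,v): least i such that v is within distance i of u
   (for a connected graph such an i < #|T| exists) *)
Definition dist (u v : T) : nat :=
  find (fun i => v \in ball i u) (iota 0 #|T|).

Definition ecc (u : T) : nat := \max_(v : T) dist u v.

Definition edges : {set {set T}} :=
  [set [set x; y] | x in T, y in T & g x y].

Definition sigma2 : nat := \sum_(e in edges) \prod_(x in e) ecc x.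

Definition is_matching (M : {set {set T}}) : bool :=
  (M \subset edges) &&
  [forall e1 in M, forall e2 in M, (e1 != e2) ==> [disjoint e1 & e2]].

Definition matching_number : nat :=
  \max_(M : {set {set T}} | is_matching M) #|M|.

Definition is_complete : Prop := forall x y : T, x != y -> g x y.

Definition isomorphic_to (m : nat) (h : rel 'I_m) : Prop :=
  exists f : T -> 'I_m, bijective f /\ forall x y, g x y = h (f x) (f y).

End Graphs.

(* Model of K_1 \/ ((k-1)K_2 + \bar K_{n+1-2k}) on vertices 0..n-1:
   0 is the apex, {2i-1, 2i} (1 <= i <= k-1) are the K_2's, the rest isolated
   in the second part. *)
Definition split_model (n k : nat) : rel 'I_n :=
  fun i j => (i != j) &&
    [|| (i == 0 :> nat), (j == 0 :> nat) |
        [&& 1 <= i <= 2 * (k - 1), 1 <= j <= 2 * (k - 1) &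
            (i.+1)./2 == (j.+1)./2]].
Arguments split_model : clear implicits.

(* Main.v *)
Require Import Defs.
From mathcomp Require Import all_boot.
From mathcomp Require Import zify.

(** Let A be the set of universal vertices, a = #|A|, and count edges as ordered
    adjacent pairs. If a = 0, all eccentricities are at least 2, and connectedness
    gives n - 1 edges, so sigma2 >= 4(n - 1). If a > 0, the vertices off A have
    eccentricity 2, so 2 sigma2 = a(a - 1) + 4a(n - a) + 4p where p counts the
    ordered adjacent pairs off A. A maximum matching loses at most a edges when
    A is deleted, hence p >= 2(k - a). Outside the exceptional range the resulting
    lower bound is attained only at a = 1 and p = 2(k - 1); then the graph induced
    off A has all degrees at most 1, which forces the extremal graph. In the
    exceptional range only a = n is optimal. *)

(** Prepending one orbit {x, m x} at a time puts partners at positions 2i and 2i+1. With the apex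
    placed in front of [s], these become the blocks {2i-1, 2i} of [split_model]. *)
Lemma involution_pairing (T : finType) (m : T -> T) (D : {set T}) :
  {in D, forall x, [/\ m x \in D, m (m x) = x & m x != x]} ->
  exists s : seq T, [/\ uniq s, s =i D &
    {in D, forall x, (index (m x) s)./2 = (index x s)./2}].
Proof.
have [c] := ubnP #|D|; elim: c => // c IH in D *; rewrite ltnS => leDc mP.
have [->|[x xD]] := set_0Vmem D.
  by exists [::]; split=> // x; rewrite !inE.
have [mxD mmx mx] := mP x xD.
have [||s [s_uniq sD s_half]] := IH (D :\ x :\ m x).
- by move: leDc; rewrite (cardsD1 x D) (cardsD1 (m x) (D :\ x)) !inE xD mxD mx; lia.
- move=> y; rewrite !inE => /and3P[ymx yx yD]; have [myD mmy my] := mP y yD.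
  split=> //; rewrite myD andbT; apply/andP; split.
    by apply: contra_neq yx => e; rewrite -mmy e mmx.
  by apply: contra_neq ymx => e; rewrite -mmy e.
have neq_xmx : x != m x by rewrite eq_sym.
exists [:: x, m x & s]; split=> [|y|y yD].
- by rewrite /= inE !sD !inE !eqxx (negPf neq_xmx) s_uniq ?andbF.
- rewrite !inE sD !inE; have [->|yx] := eqVneq y x => //=.
  by have [->|ymx] := eqVneq y (m x).
rewrite /=; have [->|yx] := eqVneq x y.
  by rewrite eqxx; case: eqP => //; case: eqP.
have [<-|ymx] := eqVneq (m x) y.
  by rewrite mmx !eqxx.
have [myD mmy my] := mP y yD.
have -> : (x == m y) = false by apply: contraNF ymx => /eqP ->; rewrite mmy.
have -> : (m x == m y) = false.
  by apply: contraNF yx => /eqP e; rewrite -mmx e mmy.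
by rewrite /= s_half // !inE eq_sym ymx eq_sym yx.
Qed.

(** * Distances and eccentricities *)

Section SymmetricGraph.
Variables (T : finType) (g : rel T).
Hypotheses (gsym : symmetric g) (girr : irreflexive g).

Lemma dist_leq (i : nat) (u v : T) : i < #|T| -> v \in ball g i u -> dist g u v <= i.
Proof.
move=> ltiT vi; rewrite /dist leqNgt; apply/negP => lt_i.
by have := before_find 0 lt_i; rewrite nth_iota // add0n vi.
Qed.

(** The excluded value [#|T|] is what [find] returns when no listed ball contains v. *)
Lemma mem_ball_dist (u v : T) : dist g u v < #|T| -> v \in ball g (dist g u v) u.
Proof.
move=> lt_d; have hasb : has (fun i => v \in ball g i u) (iota 0 #|T|).
  by rewrite has_find size_iota.
by have := nth_find 0 hasb; rewrite nth_iota.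
Qed.

Lemma mem_ball1 (u v : T) : (v \in ball g 1 u) = (v == u) || g u v.
Proof.
rewrite /= !inE; congr (_ || _); apply/existsP/idP => [[x]|guv].
  by rewrite inE => /andP[/eqP->].
by exists u; rewrite inE eqxx.
Qed.

Definition universal : {set T} := [set u | [forall v, (v != u) ==> g u v]].

Lemma universalP (u : T) : reflect (forall v, v != u -> g u v) (u \in universal).
Proof.
by rewrite inE; apply: (iffP forallP) => h v; [apply/implyP | apply/implyP/h].
Qed.

Lemma card_universal_complete : #|universal| = #|T| <-> is_complete g.
Proof.
split=> [cardU x y neq_xy | gK].
  have /universalP -> // : x \in universal; last by rewrite eq_sym.
  suff -> : universal = setT by rewrite inE.
  by apply/eqP; rewrite eqEcard subsetT cardsT cardU /=.
suff -> : universal = setT by rewrite cardsT.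
apply/setP => x; rewrite [RHS]inE; apply/universalP => y neq_yx.
by apply: gK; rewrite eq_sym.
Qed.

(** Some v other than u is outside the ball of radius 1, so [dist g u v] is neither 0 nor 1; the
    default value [#|T|] also exceeds 1. *)
Lemma ecc_gt1 (u : T) : 1 < #|T| -> u \notin universal -> 1 < ecc g u.
Proof.
move=> T_gt1; rewrite inE negb_forall => /existsP[v].
rewrite negb_imply => /andP[neq_vu ngv].
apply: leq_trans (leq_bigmax (F := fun v => dist g u v) v).
rewrite ltnNge; apply/negP => le1.
have := mem_ball_dist u v (leq_ltn_trans le1 T_gt1).
case: (dist g u v) le1 => [|[|//]] _.
  by rewrite inE (negPf neq_vu).
by rewrite mem_ball1 (negPf neq_vu) (negPf ngv).
Qed.

Lemma ecc_universal (u : T) : 1 < #|T| -> u \in universal -> ecc g u = 1.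
Proof.
move=> T_gt1 uU; apply/eqP; rewrite eqn_leq; apply/andP; split.
  apply/bigmax_leqP => v _; apply: dist_leq => //; rewrite mem_ball1.
  by case: eqVneq => //= neq_vu; apply: (universalP _ uU).
have [v neq_vu] : exists v, v != u.
  have /card_gt0P[v] : 0 < #|[set~ u]| by rewrite cardsC1; lia.
  by rewrite !inE; exists v.
apply: leq_trans (leq_bigmax (F := fun v => dist g u v) v).
rewrite lt0n; apply/eqP => d0.
have := mem_ball_dist u v; rewrite d0 => /(_ (ltnW T_gt1)).
by rewrite inE (negPf neq_vu).
Qed.

(** A universal vertex z is a common stop on the way from u to any other vertex. *)
Lemma ecc_eq2 (u : T) : 2 < #|T| -> universal != set0 -> u \notin universal -> ecc g u = 2.
Proof.
move=> T_gt2 /set0Pn[z zU] unU; apply/eqP; rewrite eqn_leq (ecc_gt1 _ (ltnW T_gt2) unU) andbT.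
have neq_uz : u != z by apply: contraNneq unU => ->.
apply/bigmax_leqP => v _; apply: dist_leq => //.
rewrite -[ball _ _ _]/(ball g 1 u :|: [set y | [exists x in ball g 1 u, g x y]]).
have guz : g u z by rewrite gsym; apply: (universalP _ zU).
have z1 : z \in ball g 1 u by rewrite mem_ball1 guz orbT.
rewrite in_setU inE; have [->|neq_vz] := eqVneq v z; first by rewrite z1.
apply/orP; right; apply/existsP; exists z.
by rewrite z1 (universalP _ zU).
Qed.

(** * Summation over ordered adjacent pairs *)

(** The fibre of (x, y) |-> {x, y} over an edge {a, b} consists of the two distinct pairs (a, b) and
    (b, a). *)
Lemma sum_edges_pairs (w : T -> nat) :
  2 * (\sum_(e in edges g) \prod_(x in e) w x) = \sum_x \sum_(y | g x y) w x * w y.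
Proof.
rewrite pair_big_dep /=.
rewrite (partition_big (fun p : T * T => [set p.1; p.2]) (fun e => e \in edges g)) /=; last first.
  by move=> [x y] /= gxy; apply/imset2P; exists x y; rewrite ?inE.
rewrite big_distrr /=; apply: eq_bigr => e /imset2P[a b _].
rewrite !inE /= => gab ->.
have neq_ab : a != b by apply: contraTneq gab => ->; rewrite girr.
rewrite (bigD1 (a, b)) /=; last by rewrite gab eqxx.
rewrite (bigD1 (b, a)) /=; last first.
  by rewrite gsym gab setUC eqxx xpair_eqE negb_and eq_sym neq_ab.
rewrite [X in _ + (_ + X)]big1 => [|[x y] /= /andP[/andP[/andP[gxy /eqP exy] ne1] ne2]]; last first.
  have neq_xy : x != y by apply: contraTneq gxy => ->; rewrite girr.
  have : (x \in [set a; b]) && (y \in [set a; b]) by rewrite -exy !inE !eqxx orbT.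
  rewrite !inE => /andP[xab yab]; move: neq_xy ne1 ne2.
  by case/pred2P: xab => ->; case/pred2P: yab => ->; rewrite eqxx.
by rewrite big_setU1 ?inE //= big_set1; lia.
Qed.

Definition nonuniversal_nbrs (x : T) : {set T} := [set y | (y \notin universal) && g x y].

(** This is the p of the overview: an edge off [universal] counts from both ends. *)
Definition nonuniversal_pairs : nat := \sum_(x in ~: universal) #|nonuniversal_nbrs x|.

(** With a = [#|universal|] and n = [#|T|], a universal vertex contributes the row sum (a - 1) + 2(n
    - a), and any other vertex contributes 2a plus 4 for each neighbour off [universal]. *)
Lemma sigma2_universal : 2 < #|T| -> universal != set0 ->
  2 * sigma2 g = #|universal| * #|universal|.-1
    + 4 * #|universal| * (#|T| - #|universal|) + 4 * nonuniversal_pairs.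
Proof.
move=> T_gt2 U0; set A := universal.
pose w x := if x \in A then 1 else 2.
have eccE x : ecc g x = w x.
  rewrite /w; case: ifPn => xA; first by rewrite ecc_universal // ltnW.
  by rewrite ecc_eq2.
have sumA (P : pred T) : \sum_(y | P y && (y \in A)) w y = #|[set y in A | P y]|.
  rewrite -sum1_card; apply: eq_big => [y|y /andP[_ yA]]; first by rewrite inE andbC.
  by rewrite /w yA.
have sumC (P : pred T) : \sum_(y | P y && (y \notin A)) w y = 2 * #|[set y | (y \notin A) && P y]|.
  rewrite -sum1_card big_distrr /=; apply: eq_big => [y|y /andP[_ yA]]; first by rewrite inE andbC.
  by rewrite /w (negPf yA).
have aT : #|A| <= #|T| := max_card _.
have cC : #|~: A| = #|T| - #|A| by rewrite cardsCs setCK.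
rewrite /sigma2 sum_edges_pairs (bigID (fun x => x \in A)) /=.
rewrite (eq_bigr (fun _ => #|A|.-1 + 2 * (#|T| - #|A|))); last first.
  move=> x xA; rewrite (bigID (fun y => y \in A)) /=.
  rewrite -!big_distrr /= (eccE x) {1 2}/w xA !mul1n.
  under eq_bigr => y _ do rewrite eccE.
  under [X in _ + X]eq_bigr => y _ do rewrite eccE.
  rewrite sumA sumC; congr (_ + 2 * _).
    rewrite (cardsD1 x A) xA /=; apply: eq_card => y.
    rewrite [LHS]in_set in_setD1 andbC.
    have [->|neq] := eqVneq y x; first by rewrite girr.
    by rewrite (universalP _ xA).
  rewrite -cC; apply: eq_card => y; rewrite [LHS]in_set in_setC.
  have [yA|/= yA] := boolP (y \in A) => //=.
  by rewrite (universalP _ xA) //; apply: contraNneq yA => ->.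
rewrite sum_nat_const (eq_bigl (fun x => x \in ~: A)) => [|x]; last by rewrite in_setC.
rewrite (eq_bigr (fun x => 2 * #|A| + 4 * #|nonuniversal_nbrs x|)); last first.
  move=> x; rewrite in_setC => xA; rewrite (bigID (fun y => y \in A)) /=.
  rewrite -!big_distrr /= (eccE x) {1 2}/w (negPf xA).
  under eq_bigr => y _ do rewrite eccE.
  under [X in _ + _ * X]eq_bigr => y _ do rewrite eccE.
  rewrite sumA sumC mulnA; congr (2 * _ + _).
  apply: eq_card => y; rewrite [LHS]in_set; have [yA|//] := boolP (y \in A).
  rewrite gsym (universalP _ yA) //; by apply: contraNneq xA => ->.
rewrite big_split /= sum_nat_const cC /nonuniversal_pairs big_distrr /=.
move: #|A|.-1 (#|T| - #|A|) (\sum_(i in _) _) => p c s; nia.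
Qed.

(** * Matchings and the vertices off [universal] *)

(** Double counting: each vertex of S lies in at most one edge of M. *)
Lemma sum_card_matching (M : {set {set T}}) (S : {set T}) :
  is_matching g M -> \sum_(e in M) #|e :&: S| <= #|S|.
Proof.
case/andP=> _ disjM.
under eq_bigr => e _ do rewrite -sum1_card (eq_bigl _ _ (fun x => in_setI x e S)) big_mkcondl.
rewrite exchange_big /= -sum1_card leq_sum // => x xS.
rewrite -big_mkcondr sum1_card; apply/card_le1_eqP => e1 e2.
move=> /andP[e1M xe1] /andP[e2M xe2]; apply/eqP/contraT => neq.
have := forall_inP (forall_inP disjM _ e2M) _ e1M.
by rewrite neq => /pred0P/(_ x) /=; rewrite xe1 xe2.
Qed.

Lemma matching_exists : exists2 M, is_matching g M & #|M| = matching_number g.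
Proof.
have M0 : is_matching g set0.
  by rewrite /is_matching sub0set; apply/forall_inP => e; rewrite inE.
have M_gt0 : 0 < #|is_matching g| by apply/card_gt0P; exists set0.
have [M MM ME] := eq_bigmax_cond (fun M : {set {set T}} => #|M|) M_gt0.
by exists M.
Qed.

(** The size of this set mediates between the matching number and p. If it equals p, all degrees off
    [universal] are at most 1. *)
Definition nonuniversal_touched : {set T} :=
  [set x in ~: universal | nonuniversal_nbrs x != set0].

(** Give touched vertices weight 1 and universal ones weight 2. Every matching edge weighs at least
    2, and disjoint edges weigh at most the total. *)
Lemma matching_touched :
  2 * matching_number g <= #|nonuniversal_touched| + 2 * #|universal|.
Proof.
have [M MM <-] := matching_exists.
apply: (@leq_trans (\sum_(e in M) (#|e :&: nonuniversal_touched| + 2 * #|e :&: universal|))).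
  rewrite mulnC -sum_nat_const leq_sum // => e eM.
  (* A matching edge either meets [universal] or has both ends touched. *)
  have [e_disj|] := eqVneq (e :&: universal) set0; last first.
    by rewrite -card_gt0; lia.
  case/andP: MM => /subsetP /(_ _ eM) /imset2P[x y _].
  rewrite !inE /= => gxy def_e _.
  have eU z : z \in e -> z \notin universal.
    by move=> ze; apply/negP => zU; have /setP/(_ z) := e_disj; rewrite in_setI ze zU inE.
  have [xU yU] : x \notin universal /\ y \notin universal.
    by split; apply: eU; rewrite def_e ?set21 ?set22.
  have /setIidPl -> : e \subset nonuniversal_touched.
    apply/subsetP => z; rewrite def_e [_ \in nonuniversal_touched]in_set in_setC.
    case/set2P=> ->; rewrite ?xU ?yU; apply/set0Pn.
      by exists y; rewrite in_set yU.
    by exists x; rewrite in_set xU gsym.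
  have neq_xy : x != y by apply: contraTneq gxy => ->; rewrite girr.
  by rewrite def_e cards2 neq_xy.
rewrite big_split /= -big_distrr /= leq_add ?leq_mul2l ?sum_card_matching //.
Qed.

Lemma card_touched : #|nonuniversal_touched| =
  \sum_(x in ~: universal) (nonuniversal_nbrs x != set0).
Proof.
rewrite -sum1_card big_mkcond [RHS]big_mkcond /=; apply: eq_bigr => x _.
by rewrite in_set; case: (x \in _) => //; case: (_ != _).
Qed.

Lemma card_touched_leq : #|nonuniversal_touched| <= nonuniversal_pairs.
Proof. by rewrite card_touched leq_sum // => x _; rewrite -card_gt0; case: #|_|. Qed.

(** * Connected graphs without universal vertices *)

Lemma sum_degree_connected : connected_graph g ->
  2 * #|T|.-1 <= \sum_x #|[set y | g x y]|.
Proof.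
move=> conn; have [->|T_gt0] := posnP #|T|; first by [].
(* Grow a vertex set along crossing edges, one vertex at a time. *)
suff grow m : m < #|T| -> exists2 S : {set T}, #|S| = m.+1 &
    2 * m <= \sum_(x in S) #|[set y in S | g x y]|.
  have [|S cardS le_sum] := grow #|T|.-1; first by rewrite prednK.
  apply: leq_trans le_sum _; rewrite [leqRHS](bigID (fun x => x \in S)) /=.
  apply: leq_trans (leq_addr _ _); apply: leq_sum => x xS.
  by apply/subset_leq_card/subsetP => y; rewrite !inE => /andP[].
elim: m => [_|m IH lt_m].
  by have /card_gt0P[r _] := T_gt0; exists [set r]; rewrite ?cards1.
have [S cardS le_sum] := IH (ltnW lt_m).
(* Without a crossing edge, S is closed under adjacency, hence everything by connectedness, against
   its size. *)
have [x xS [y yS gxy]] : exists2 x, x \in S & exists2 y, y \notin S & g x y.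
  have /existsP[x /andP[xS /existsP[y /andP[yS gxy]]]] :
      [exists x, (x \in S) && [exists y, (y \notin S) && g x y]]; last first.
    by exists x => //; exists y.
  apply: contraLR lt_m; rewrite negb_exists => /forallP noedge.
  rewrite -leqNgt -cardS; apply/subset_leq_card/subsetP => z _.
  have /card_gt0P[r rS] : 0 < #|S| by rewrite cardS.
  have clS : closed g (mem S).
    apply: intro_closed; first exact: sym_connect_sym.
    move=> u v guv uS; have := noedge u; have -> : u \in S by exact: uS.
    rewrite negb_exists.
    by move=> /forallP/(_ v); rewrite guv andbT negbK.
  by rewrite -[z \in S](closed_connect clS (conn r z)).
exists (y |: S); first by rewrite cardsU1 yS cardS.
rewrite big_setU1 //=.
have ynbr : 0 < #|[set z in y |: S | g y z]|.
  by apply/card_gt0P; exists x; rewrite !inE xS orbT gsym.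
(* The edge xy yields both new ordered pairs: one in the row of y, by [ynbr], and one in the row of
   x. *)
suff : (\sum_(z in S) #|[set t in S | g z t]|) < \sum_(z in S) #|[set t in y |: S | g z t]| by lia.
rewrite (bigD1 x) //= [ltnRHS](bigD1 x) //= -addSn leq_add //.
  apply/proper_card/properP; split.
    by apply/subsetP => t; rewrite !inE => /andP[-> ->]; rewrite orbT.
  by exists y; rewrite !inE ?eqxx ?(negPf yS).
apply: leq_sum => z _; apply/subset_leq_card/subsetP => t.
by rewrite !inE => /andP[-> ->]; rewrite orbT.
Qed.

Lemma sigma2_no_universal : connected_graph g -> 1 < #|T| -> universal = set0 ->
  4 * #|T|.-1 <= sigma2 g.
Proof.
move=> conn T_gt1 U0.
have ecc2 x : 1 < ecc g x by apply: ecc_gt1; rewrite // U0 inE.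
suff : 4 * (2 * #|T|.-1) <= 2 * sigma2 g by lia.
rewrite /sigma2 sum_edges_pairs.
apply: leq_trans (leq_mul (leqnn 4) (sum_degree_connected conn)) _.
rewrite big_distrr /=; apply: leq_sum => x _.
rewrite mulnC -sum_nat_const; under eq_bigl => y do rewrite inE.
by apply: leq_sum => y _; rewrite (leq_mul (ecc2 x) (ecc2 y)).
Qed.

(** * The extremal graph *)

(** The sum of the degrees is at most the number of nonzero ones, so no degree exceeds its
    indicator. *)
Lemma card_nonuniversal_nbrs (x : T) :
  nonuniversal_pairs <= #|nonuniversal_touched| -> x \notin universal ->
  #|nonuniversal_nbrs x| <= 1.
Proof.
move=> le_PD xU; have xC : x \in ~: universal by rewrite in_setC.
have : \sum_(y in ~: universal | y != x) (nonuniversal_nbrs y != set0)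
    <= \sum_(y in ~: universal | y != x) #|nonuniversal_nbrs y|.
  by apply: leq_sum => y _; rewrite -card_gt0; case: #|_|.
move: le_PD; rewrite /nonuniversal_pairs card_touched (bigD1 x) //= [X in _ <= X](bigD1 x) //=.
by case: (_ != _); lia.
Qed.

(** Off the apex z all degrees are at most 1, so the touched vertices are paired by a
    fixed-point-free involution. List z, then these pairs, then the rest: the position in the list
    is the isomorphism. *)
Lemma isomorphic_split_model (k : nat) : 1 < k -> #|universal| = 1 ->
  nonuniversal_pairs = 2 * (k - 1) -> #|nonuniversal_touched| = 2 * (k - 1) ->
  isomorphic_to g (split_model #|T| k).
Proof.
move=> k_gt1 /eqP/cards1P[z UE] PE DE.
have nzU x : (x \notin universal) = (x != z) by rewrite UE in_set1.
have gz y : g z y = (y != z).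
  have [->|] := eqVneq; first by rewrite girr.
  by apply: universalP; rewrite UE set11.
set D := nonuniversal_touched in DE.
have nbrE x y : (y \in nonuniversal_nbrs x) = (y != z) && g x y by rewrite in_set nzU.
(* The default x is harmless: [m] is used only on D, where a neighbour exists. *)
pose m x := odflt x [pick y in nonuniversal_nbrs x].
have nbr_sym x y : x != z -> (y \in nonuniversal_nbrs x) -> (x \in nonuniversal_nbrs y).
  by move=> xz; rewrite !nbrE xz gsym => /andP[].
have mD x : x \in D -> x != z /\ nonuniversal_nbrs x = [set m x].
  rewrite in_set in_setC nzU => /andP[xz /set0Pn[y yN]]; split=> //.
  apply/esym/eqP; rewrite eqEcard cards1 card_nonuniversal_nbrs ?PE ?DE ?nzU // andbT.
  by rewrite sub1set /m; case: pickP => [//|/(_ y)]; rewrite yN.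
have Dnbr x y : x != z -> y \in nonuniversal_nbrs x -> x \in D.
  by move=> xz yN; rewrite in_set in_setC nzU xz; apply/set0Pn; exists y.
have mP : {in D, forall x, [/\ m x \in D, m (m x) = x & m x != x]}.
  move=> x xD; have [xz NE] := mD x xD.
  have mN : m x \in nonuniversal_nbrs x by rewrite NE set11.
  have := mN; rewrite nbrE => /andP[mz gm].
  have xN := nbr_sym _ _ xz mN; have mxD := Dnbr _ _ mz xN.
  split=> //; last by apply: contraTneq gm => ->; rewrite girr.
  by have [_ NmE] := mD _ mxD; move: xN; rewrite NmE => /set1P.
have gD x y : x != z -> y != z -> g x y = (x \in D) && (y == m x).
  move=> xz yz; have -> : g x y = (y \in nonuniversal_nbrs x) by rewrite nbrE yz.
  have [/mD[_ ->]|xD] := boolP (x \in D); first by rewrite in_set1.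
  by apply: contraNF xD; apply: Dnbr.
have [s [s_uniq sD s_half]] := involution_pairing _ _ _ mP.
have size_s : size s = 2 * (k - 1) by rewrite -DE -(card_uniqP s_uniq); apply: eq_card.
have zs : z \notin s by rewrite sD; apply/negP => /mD[]; rewrite eqxx.
pose r := [seq x <- enum T | x \notin z :: s].
have full_uniq : uniq (z :: s ++ r).
  rewrite -cat_cons cat_uniq cons_uniq zs s_uniq filter_uniq ?enum_uniq // !andbT.
  by apply/hasPn => x; rewrite mem_filter => /andP[].
have full_mem x : x \in z :: s ++ r.
  by rewrite -cat_cons mem_cat mem_filter mem_enum andbT orbN.
have size_full : size (z :: s ++ r) = #|T|.
  by rewrite -(card_uniqP full_uniq); apply: eq_card => x; rewrite full_mem.
pose ix x := index x (z :: s ++ r).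
have ix_lt x : ix x < #|T| by rewrite -size_full index_mem.
have ix_inj x y : ix x = ix y -> x = y.
  exact: index_inj (full_mem x) (full_mem y).
have s_inj x y : x \in D -> y \in D -> index x s = index y s -> x = y.
  by rewrite -!sD; apply: index_inj.
exists (fun x => Ordinal (ix_lt x)); split.
  apply: inj_card_bij; last by rewrite card_ord.
  by move=> x y /(congr1 val) e; apply: ix_inj.
have ix_z : ix z = 0 by rewrite /ix /= eqxx.
have ix_nz x : x != z -> ix x = (index x (s ++ r)).+1.
  by rewrite /ix /= eq_sym => /negPf ->.
have idx_s x : (index x (s ++ r) < size s) = (x \in D).
  rewrite index_cat -sD; case: ifPn => [xs|_]; first by rewrite index_mem.
  by rewrite ltnNge leq_addr.
move=> x y; have -> : split_model #|T| k (Ordinal (ix_lt x)) (Ordinal (ix_lt y)) =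
    (ix x != ix y) && [|| ix x == 0, ix y == 0 |
      [&& 1 <= ix x <= 2 * (k - 1), 1 <= ix y <= 2 * (k - 1) & (ix x).+1./2 == (ix y).+1./2]].
  by [].
have [->|xz] := eqVneq x z.
  by rewrite gz ix_z andbT eq_sym; have [->|/ix_nz->] := eqVneq y z; rewrite ?ix_z.
have [->|yz] := eqVneq y z; first by rewrite gsym gz xz ix_z (ix_nz _ xz).
rewrite gD // (ix_nz _ xz) (ix_nz _ yz) eqSS /= -size_s !idx_s.
have [xD|] := boolP (x \in D); last by rewrite andbF.
have [mxD mmx mx] := mP x xD.
have half_m := s_half x xD.
have idxE t : t \in D -> index t (s ++ r) = index t s by rewrite index_cat sD => ->.
have neqm : index (m x) s != index x s.
  by apply: contra_neq mx; apply: s_inj.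
have [->|ym] := eqVneq y (m x).
  by rewrite mxD !idxE // eq_sym neqm; lia.
(* Only two positions share a half, and x and [m x] occupy them, so y cannot be in the block of
   x. *)
apply/esym/negbTE/negP => /and4P[] //.
move=> nxy _ yD /=.
have : index y s != index (m x) s.
  by apply: contra_neq ym; apply: s_inj.
by move: nxy; rewrite !idxE //; lia.
Qed.

(** An upper bound on p suffices, since the matching number supplies the reverse inequality. *)
Lemma split_model_structure (k : nat) : 5 < #|T| -> 1 < k -> 2 * k <= #|T| ->
  isomorphic_to g (split_model #|T| k) ->
  #|universal| = 1 /\ nonuniversal_pairs <= 2 * (k - 1).
Proof.
move=> T_gt5 k_gt1 k_le [f [f_bij gE]].
have [f' fK f'K] := f_bij.
have T_gt0 : 0 < #|T| by lia.
pose z := f' (Ordinal T_gt0).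
have fz x : (f x == 0 :> nat) = (x == z).
  apply/eqP/eqP => [fx0|->]; last by rewrite f'K.
  by rewrite -(fK x); congr f'; apply: val_inj.
have f_inj x y : (f x == f y :> nat) = (x == y) by rewrite (inj_eq val_inj) (bij_eq f_bij).
have gP x y : x != z -> y != z -> g x y =
    [&& x != y, 1 <= f x <= 2 * (k - 1), 1 <= f y <= 2 * (k - 1) & ((f x).+1)./2 == ((f y).+1)./2].
  move=> xz yz; rewrite gE /split_model -val_eqE f_inj !fz (negPf xz) (negPf yz) /=.
  by [].
have UE : universal = [set z].
  apply/setP => x; rewrite in_set1; apply/universalP/eqP => [gx|-> y yz]; last first.
    by rewrite gE /split_model -val_eqE f_inj fz eqxx eq_sym yz.
  apply/eqP/contraT => xz.
  (* Labels 1 and 3 belong to different blocks, so one of them is outside the block of x and gives a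
     non-neighbour. *)
  have [j [j_lt j_gt0 j_far]] : exists j, [/\ j < #|T|, 0 < j & j.+1./2 != (f x).+1./2].
    have [le2|gt2] := leqP (f x) 2; first by exists 3; split; lia.
    by exists 1; split; lia.
  have fy : f (f' (Ordinal j_lt)) = Ordinal j_lt by rewrite f'K.
  have yz : f' (Ordinal j_lt) != z by rewrite -fz fy -lt0n.
  have yx : f' (Ordinal j_lt) != x.
    by apply: contraNneq j_far => <-; rewrite fy.
  have := gx _ yx; rewrite gP // fy => /and4P[_ _ _ /eqP e].
  by rewrite e eqxx in j_far.
split; first by rewrite UE cards1.
have nzU x : (x \in ~: universal) = (x != z) by rewrite UE in_setC in_set1.
have nbrE x y : (y \in nonuniversal_nbrs x) = (y != z) && g x y by rewrite in_set -in_setC nzU.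
rewrite /nonuniversal_pairs.
(* A vertex labelled in this range has at most one neighbour off z; the other vertices besides z
   have none. *)
apply: (@leq_trans #|[set x | 1 <= f x <= 2 * (k - 1)]|).
  rewrite -sum1_card [leqRHS](eq_bigl (fun x => (x \in ~: universal) && (f x <= 2 * (k - 1)))).
    rewrite big_mkcondr; apply: leq_sum => x; rewrite nzU => xz.
    case: ifPn => [_|f_big].
      apply/card_le1_eqP => y1 y2; rewrite !nbrE.
      move=> /andP[y1z]; rewrite gP // => /and4P[n1 _ _ h1].
      move=> /andP[y2z]; rewrite gP // => /and4P[n2 _ _ h2].
      apply/eqP; rewrite -f_inj; move: n1 n2; rewrite -!f_inj; lia.
    rewrite leqn0 cards_eq0; apply/eqP/setP => y; rewrite nbrE in_set0.
    by apply/andP => -[yz]; rewrite gP // => /and4P[_]; lia.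
  by move=> x; rewrite nzU in_set -fz; lia.
have uniq_im : uniq [seq nat_of_ord (f x) | x <- enum [set x | 1 <= f x <= 2 * (k - 1)]].
  by rewrite map_inj_uniq ?enum_uniq // => x y /eqP; rewrite f_inj => /eqP.
rewrite cardE -(size_map (fun x => nat_of_ord (f x))) -[leqRHS](size_iota 1).
apply: uniq_leq_size => // i /mapP[x]; rewrite mem_enum in_set => fx ->.
by rewrite mem_iota; lia.
Qed.

End SymmetricGraph.

(** * Numerical inequalities *)

Lemma sigma2_arith (n k a p : nat) :
  1 < a <= n -> 1 < k -> 2 * k <= n -> 5 < n -> (n == 6) ==> (k == 2) ->
  2 * k <= p + 2 * a ->
  2 * (2 * n + 4 * k - 6) < a * a.-1 + 4 * a * (n - a) + 4 * p.
Proof.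
move=> /andP[a_gt1 le_an] k_gt1 k_le n_gt5 n6 p_ge.
have [c nE] : exists c, n = a + c by exists (n - a); lia.
have -> : a.-1 = a - 1 by lia.
(* For 4n <= 3a + 12 the term 4p is dropped: the rest is concave in a. *)
have [small|large] := ltnP (3 * a + 12) (4 * n).
  (* After 4p >= 8k - 8a is inserted, the difference of the two sides is exactly this product. *)
  have : 0 < (a - 1) * (4 * n - 3 * a - 12) by rewrite muln_gt0; lia.
  subst n; nia.
(* At a = n, the bound 2k <= n leaves the difference n^2 - 9n + 12, positive from n = 8 on. For n =
   7 integrality gives k <= 3, and for n = 6 the hypothesis gives k = 2. *)
have [n_ge8|n_lt8] := leqP 8 n.
  subst n; nia.
have [e|e] : n = 6 \/ n = 7 by lia.
  subst n; nia.
subst n; nia.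
Qed.

(** For a = 0, 4(n - 1) exceeds n(n - 1)/2 because n < 8. The remaining values of a, at most 6, are
    checked one by one. *)
Lemma sigma2_arith_small (n k a p s : nat) :
  [\/ n = 4 /\ k = 2, n = 5 /\ k = 2 | n = 6 /\ k = 3] ->
  a <= n -> 2 * k <= p + 2 * a ->
  (a = 0 -> 4 * n.-1 <= s) ->
  (0 < a -> 2 * s = a * a.-1 + 4 * a * (n - a) + 4 * p) ->
  (a = n -> p = 0) ->
  'C(n, 2) <= s /\ (s = 'C(n, 2) <-> a = n).
Proof.
move=> nk le_an p_ge a0 a_gt0 aT.
have [a0E|a1] := posnP a.
  by have := a0 a0E; case: nk => -[-> _]; rewrite bin2 /=; lia.
have {a_gt0} sE := a_gt0 a1; move: a1 le_an p_ge aT sE => {a0}.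
case: nk => -[-> ->]; rewrite bin2 /=;
  do 7?[case: a => [|a]]; move=> *; lia.
Qed.

(** * Case distinction and equality *)

Theorem theorem5p5 (T : finType) (g : rel T)
    (gsym : symmetric g) (girr : irreflexive g) (k : nat) :
  connected_graph g ->
  matching_number g = k ->
  2 <= k <= #|T| %/ 2 ->
  if (4 <= #|T| <= 6) && (k == #|T| %/ 2) then
    'C(#|T|, 2) <= sigma2 g /\ (sigma2 g = 'C(#|T|, 2) <-> is_complete g)
  else
    2 * #|T| + 4 * k - 6 <= sigma2 g /\
    (sigma2 g = 2 * #|T| + 4 * k - 6 <-> isomorphic_to g (split_model #|T| k)).
Proof.
move=> conn matchE /andP[k_gt1 k_le].
have T_gt3 : 3 < #|T| by lia.
have le_aT : #|universal T g| <= #|T| := max_card _.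
have touched := matching_touched T g gsym girr; rewrite matchE in touched.
have le_DP := card_touched_leq T g.
have sE : universal T g != set0 -> _ := sigma2_universal T g gsym girr (ltnW T_gt3).
have s0 : #|universal T g| = 0 -> 4 * #|T|.-1 <= sigma2 g.
  by move=> /cards0_eq; apply: sigma2_no_universal => //; lia.
have U_gt0 : (universal T g != set0) = (0 < #|universal T g|) by rewrite card_gt0.
rewrite U_gt0 in sE.
case: ifPn => [exc|nexc].
  suff [bound eqv] : 'C(#|T|, 2) <= sigma2 g /\
      (sigma2 g = 'C(#|T|, 2) <-> #|universal T g| = #|T|).
    by split=> //; apply: iff_trans eqv (card_universal_complete T g).
  have PE : #|universal T g| = #|T| -> nonuniversal_pairs T g = 0.
    move=> UT; rewrite /nonuniversal_pairs big1 // => x; rewrite in_setC.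
    have -> : universal T g = setT by apply/eqP; rewrite eqEcard subsetT cardsT UT /=.
    by rewrite in_setT.
  apply: (@sigma2_arith_small #|T| k #|universal T g| (nonuniversal_pairs T g)) => //; last by lia.
  case/andP: exc => /andP[n4 n6] /eqP kE.
  have [nE|[nE|nE]] : #|T| = 4 \/ #|T| = 5 \/ #|T| = 6 by lia.
  - by apply: Or31; lia.
  - by apply: Or32; lia.
  - by apply: Or33; lia.
(* For n = 4 or 5 the only admissible k is 2, which is exceptional. *)
have T_gt5 : 5 < #|T|.
  by move: nexc; rewrite negb_and; case: eqP; lia.
have n6 : (#|T| == 6) ==> (k == 2).
  by apply/implyP => /eqP nE; move: nexc k_le; rewrite nE; case: eqP; lia.
have k_le2 : 2 * k <= #|T| by lia.
have key : 2 * #|T| + 4 * k - 6 <= sigma2 g /\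
    (sigma2 g = 2 * #|T| + 4 * k - 6 <->
     #|universal T g| = 1 /\ nonuniversal_pairs T g <= 2 * (k - 1)).
  have p_ge : 2 * k <= nonuniversal_pairs T g + 2 * #|universal T g| by lia.
  have [a0|a_gt0] := posnP #|universal T g|.
    (* Since 2k <= n, the bound 2n + 4k - 6 is below 4(n - 1). *)
    by have := s0 a0; lia.
  have := sE a_gt0; have [a_gt1|a_le1] := ltnP 1 #|universal T g|.
    have a_rng : 1 < #|universal T g| <= #|T| by rewrite a_gt1.
    have := sigma2_arith #|T| k #|universal T g| (nonuniversal_pairs T g) a_rng k_gt1 k_le2 T_gt5 n6 p_ge.
    by move=> + sEq; rewrite -sEq; lia.
  have aE : #|universal T g| = 1 by lia.
  (* Here sigma2 = 2(n - 1) + 2p with p >= 2(k - 1). *)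
  by rewrite aE in p_ge *; lia.
case: key => bound eqv; split=> //; apply: iff_trans eqv _; split.
  (* The chain 2(k - 1) <= [#|nonuniversal_touched|] <= p <= 2(k - 1) collapses to equalities. *)
  by move=> [aE P_le]; apply: isomorphic_split_model => //; lia.
exact: split_model_structure.
Qed.
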